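(* Let $\mathbf D_{\mathcal S}=(\mathbf u,\widetilde{\mathbf y}_{\mathcal S})$ be given protected data and let $\mathscr L$ be an arbitrary loss function. Then $$\inf_{\mathscr A}\ \sup_{\widetilde{\mathbf y}_{\mathcal U}}\ \sup_{(A,B,C)\in\Sigma((\mathbf D_{\mathcal S},\widetilde{\mathbf y}_{\mathcal U}))}\mathscr L\big(\mathscr A((\mathbf D_{\mathcal S},\widetilde{\mathbf y}_{\mathcal U})),(A,B,C)\big)=\inf_{\mathscr A_{\mathcal S}}\ \sup_{(A,B,C)\in\Sigma_{\mathcal S}(\mathbf D_{\mathcal S})}\mathscr L\big(\mathscr A_{\mathcal S}(\mathbf D_{\mathcal S}),(A,B,C)\big),$$ where $\mathscr A$ ranges over all design rules based on full data, $\mathscr A_{\mathcal S}$ ranges over all design rules based on protected data, and $\widetilde{\mathbf y}_{\mathcal U}$ ranges over all of $\mathbb R^{|\mathcal U|N}$.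
   Context: Fix dimensions $n,m,p\geq 1$ and a data length $N\ge 1$. Output indices $\{1,\dots,p\}$ are partitioned into protected indices $\mathcal S$ and unprotected indices $\mathcal U$. A full dataset is $\mathbf D=(\mathbf D_{\mathcal S},\widetilde{\mathbf y}_{\mathcal U})$ with protected part $\mathbf D_{\mathcal S}=(\mathbf u,\widetilde{\mathbf y}_{\mathcal S})$, where $\mathbf u(k)\in\mathbb R^m$, $\widetilde{\mathbf y}_{\mathcal S}(k)\in\mathbb R^{|\mathcal S|}$, $\widetilde{\mathbf y}_{\mathcal U}(k)\in\mathbb R^{|\mathcal U|}$, $k\in[0,N-1]$. For $C\in\mathbb R^{p\times n}$, $C_{\mathcal S}$ and $C_{\mathcal U}$ are the submatrices of rows indexed by $\mathcal S$ and $\mathcal U$. The set of systems consistent with the full data is $$\Sigma(\mathbf D)=\{(A,B,C):\ \exists\,\mathbf x_0,\ \exists\,\mathbf a\in\mathbb R^{pN}\text{ s.t. } \mathbf x(0)=\mathbf x_0,\ \mathbf x(k+1)=A\mathbf x(k)+B\mathbf u(k),\ \widetilde{\mathbf y}_{\mathcal S}(k)=C_{\mathcal S}\mathbf x(k),\ \widetilde{\mathbf y}_{\mathcal U}(k)=C_{\mathcal U}\mathbf x(k)+\mathbf a_{\mathcal U}(k),\ \forall k\in[0,N-1]\},$$ and the set of systems consistent with the protected data is $$\Sigma_{\mathcal S}(\mathbf D_{\mathcal S})=\{(A,B,C):\ \exists\,\mathbf x_0\text{ s.t. } \mathbf x(0)=\mathbf x_0,\ \mathbf x(k+1)=A\mathbf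 x(k)+B\mathbf u(k),\ \widetilde{\mathbf y}_{\mathcal S}(k)=C_{\mathcal S}\mathbf x(k),\ \forall k\in[0,N-1]\},$$ with $A\in\mathbb R^{n\times n}$, $B\in\mathbb R^{n\times m}$, $C\in\mathbb R^{p\times n}$. (For every $\widetilde{\mathbf y}_{\mathcal U}$ one has $\Sigma((\mathbf D_{\mathcal S},\widetilde{\mathbf y}_{\mathcal U}))=\Sigma_{\mathcal S}(\mathbf D_{\mathcal S})$, so the domain of the loss below does not depend on $\widetilde{\mathbf y}_{\mathcal U}$.) $\Pi$ is a set (the class of admissible controllers). A design rule based on full data is an arbitrary map $\mathscr A:\mathbf D\mapsto\pi\in\Pi$ on full datasets. A design rule based on protected data is a map $\mathscr A_{\mathcal S}:\mathbf D_{\mathcal S}\mapsto\pi\in\Pi$ of the form $\mathscr A_{\mathcal S}(\mathbf D_{\mathcal S})=\mathscr A((\mathbf D_{\mathcal S},0))$ for some full-data rule $\mathscr A$ (equivalently, an arbitrary map from protected datasets to $\Pi$). A loss function is an arbitrary function $\mathscr L:\Pi\times\Sigma(\mathbf D)\to\mathbb R\cup\{+\infty\}$. Infima and suprema are taken in the extended reals. *)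

(* Defs.v *)
From HB Require Import structures.
From mathcomp Require Import all_boot all_order all_algebra.
From mathcomp Require Import all_classical all_reals all_analysis.

Set Implicit Arguments.
Unset Strict Implicit.
Unset Printing Implicit Defensive.

Local Open Scope classical_set_scope.
Local Open Scope ring_scope.

Definition signal (R : realType) (N d : nat) : Type := {ffun 'I_N -> 'cV[R]_d}.

(* The library enumerates S in increasing order, so [subrows S M] keeps the
   rows of M in their original order. *)
Definition subrows (R : realType) (p q : nat) (S : {set 'I_p})
  (M : 'M[R]_(p, q)) : 'M[R]_(#|S|, q) :=
  rowsub (fun i : 'I_#|S| => enum_val i) M.

(* (u, y_S) *)
Definition protected_data (R : realType) (N m p : nat) (S : {set 'I_p}) : Type :=
  (signal R N m * signal R N #|S|)%type.

(* ((u, y_S), y_U) *)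
Definition full_data (R : realType) (N m p : nat) (S U : {set 'I_p}) : Type :=
  (protected_data R N m S * signal R N #|U|)%type.

(* (A, B, C) *)
Definition system (R : realType) (n m p : nat) : Type :=
  ('M[R]_n * 'M[R]_(n, m) * 'M[R]_(p, n))%type.

(* Only x(0), ..., x(N) are constrained; later values of x are irrelevant. *)
Definition state_trajectory (R : realType) (N n m : nat)
  (A : 'M[R]_n) (B : 'M[R]_(n, m)) (u : signal R N m)
  (x0 : 'cV[R]_n) (x : nat -> 'cV[R]_n) : Prop :=
  x 0%N = x0 /\ forall k : 'I_N, x k.+1 = A *m x k + B *m u k.

(* The disturbance a has all p components; only those in U enter. *)
Definition Sigma (R : realType) (N n m p : nat) (S U : {set 'I_p})
  (D : full_data R N m S U) : set (system R n m p) :=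
  [set sys | let: (A, B, C) := sys in let: ((u, yS), yU) := D in
    exists (x0 : 'cV[R]_n) (a : signal R N p) (x : nat -> 'cV[R]_n),
      state_trajectory A B u x0 x /\
      forall k : 'I_N, yS k = subrows S C *m x k /\
                       yU k = subrows U C *m x k + subrows U (a k)].

Definition Sigma_protected (R : realType) (N n m p : nat) (S : {set 'I_p})
  (DS : protected_data R N m S) : set (system R n m p) :=
  [set sys | let: (A, B, C) := sys in let: (u, yS) := DS in
    exists (x0 : 'cV[R]_n) (x : nat -> 'cV[R]_n),
      state_trajectory A B u x0 x /\
      forall k : 'I_N, yS k = subrows S C *m x k].

Definition full_rule (R : realType) (N m p : nat) (S U : {set 'I_p})
  (Pi : Type) : Type := full_data R N m S U -> Pi.

Definition zero_signal (R : realType) (N d : nat) : signal R N d := [ffun=> 0].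

Definition protected_rules (R : realType) (N m p : nat) (S U : {set 'I_p})
  (Pi : Type) : set (protected_data R N m S -> Pi) :=
  [set AS | exists AA : full_rule R N m S U Pi,
     forall DS : protected_data R N m S, AS DS = AA (DS, zero_signal R N #|U|)].
Arguments protected_rules {R N m p} S U Pi.

(* Main.v *)
(** The disturbance [a_U] absorbs any unprotected output, so the consistent
    systems carry no information about [y_U]: the loss of a full-data rule
    depends on [y_U] only through the controller that it selects. Replacing [y_U]
    by [0] therefore never increases the worst case, and a protected rule is a
    full-data rule ignoring [y_U]. *)

Require Import Defs.
From HB Require Import structures.
From mathcomp Require Import all_boot all_order all_algebra.
From mathcomp Require Import all_classical all_reals all_analysis.

Set Implicit Arguments.
Unset Strict Implicit.
Unset Printing Implicit Defensive.

Import Order.TTheory GRing.Theory.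

Local Open Scope classical_set_scope.
Local Open Scope ring_scope.

Lemma subrows_surj (R : realType) (p q : nat) (S : {set 'I_p})
  (v : 'M[R]_(#|S|, q)) : exists w : 'M[R]_(p, q), subrows S w = v.
Proof.
(* The rows of [v] go to their original positions and the rows outside [S] are zero: as [enum_val]
   is injective, each sum has at most one term. *)
exists (\matrix_(i, j) \sum_(l < #|S| | enum_val l == i) v l j).
apply/matrixP => i j; rewrite !mxE (big_pred1 i) // => l /=.
exact: (inj_eq enum_val_inj).
Qed.

Lemma Sigma_eq_protected (R : realType) (N n m p : nat) (S U : {set 'I_p})
  (DS : protected_data R N m S) (yU : signal R N #|U|) :
  @Sigma R N n m p S U (DS, yU) = Sigma_protected DS.
Proof.
case: DS => u yS; apply/seteqP; split=> -[[A B] C] /=.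
  by move=> [x0 [a [x [xP yP]]]]; exists x0, x; split=> // k; case: (yP k).
move=> [x0 [x [xP yP]]].
(* The disturbance is chosen so that its rows in [U] equal the output residual at each time [k]. *)
have [a aP] := choice (fun k : 'I_N => subrows_surj (yU k - subrows U C *m x k)).
exists x0, [ffun k => a k], x; split=> // k; split; first exact: yP.
by rewrite ffunE aP addrC subrK.
Qed.

Theorem proposition3 (R : realType) (n m p N : nat)
  (hn : (1 <= n)%N) (hm : (1 <= m)%N) (hp : (1 <= p)%N) (hN : (1 <= N)%N)
  (S U : {set 'I_p})
  (hSU : U = (~: S)%SET)
  (Pi : Type) (DS : protected_data R N m S)
  (L : Pi -> system R n m p -> \bar R)
  (hL : forall (pi : Pi) (sys : system R n m p),
      Sigma_protected DS sys -> L pi sys != -oo%E) :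
  ereal_inf [set ereal_sup [set ereal_sup [set L (AA (DS, yU)) sys
                                          | sys in Sigma (DS, yU)]
                           | yU in [set: signal R N #|U|]]
            | AA in [set: full_rule R N m S U Pi]]
  = ereal_inf [set ereal_sup [set L (AS DS) sys
                             | sys in Sigma_protected DS]
              | AS in protected_rules S U Pi].
Proof.
apply/eqP; rewrite eq_le; apply/andP; split; apply: le_ereal_inf_tmp.
(* Lift [AS] to the full-data rule that discards [yU]; its worst case is then the same for every
   [yU]. *)
- move=> _ [AS _ <-]; apply: ge_ereal_inf.
  exists (ereal_sup [set ereal_sup [set L (AS DS) sys | sys in Sigma (DS, yU)]
                    | yU in [set: signal R N #|U|]]).
    by exists (fun D => AS D.1).
  by apply: ge_ereal_sup => _ [yU _ <-]; rewrite Sigma_eq_protected.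
(* Conversely, freeze the unprotected input of [AA] at zero: the resulting loss is one of the terms
   of the supremum over [yU]. *)
- move=> _ [AA _ <-]; apply: ge_ereal_inf.
  exists (ereal_sup [set L (AA (DS, zero_signal R N #|U|)) sys
                    | sys in Sigma_protected DS]).
    by exists (fun DS' => AA (DS', zero_signal R N #|U|)) => //; exists AA.
  apply: ereal_sup_ubound; exists (zero_signal R N #|U|) => //.
  by rewrite Sigma_eq_protected.
Qed.
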